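(* Let $C$ be a nonempty, closed and convex subset of a locally compact Hadamard space $\mathscr{H}$ and let $\mathcal{S}=\{S(t) : 0\le t<\infty\}$ be a continuous semigroup of nonexpansive mappings on $C$ with $F(\mathcal{S})\neq\emptyset$. Then for every $x\in C$ the orbit $\{S(t)x\}_{t\ge 0}$ is almost convergent to a common fixed point of $\mathcal{S}$.
   Context: A Hadamard space is a complete $CAT(0)$ space; $d$ denotes its metric. A continuous semigroup of nonexpansive mappings (one-parameter continuous semigroup of contractions) on $C$ is a family $\mathcal{S}=\{S(t) : 0\leq t<\infty\}$ of self-mappings $S(t):C\to C$ such that: (i) $S(0)x=x$ for all $x\in C$; (ii) $S(t+s)x=S(t)S(s)x$ for all $x\in C$ and $t,s\in[0,\infty)$; (iii) for each $x\in C$, $t\mapsto S(t)x$ is continuous on $[0,\infty)$; (iv) for each $t\in[0,\infty)$, $S(t)$ is nonexpansive on $C$, i.e. $d(S(t)x,S(t)y)\leq d(x,y)$ for all $x,y\in C$. The common fixed point set is $F(\mathcal{S})=\bigcap_{t\geq 0}F(S(t))$, where $F(S(t))=\{x\in C : S(t)x=x\}$. For $x\in C$, $T>0$ and $s\geq 0$, let $\sigma_T^s(x)$ be the unique minimizer over $y\in\mathscr{H}$ of $\mathcal{G}[x]_T^s(y)=\frac{1}{T}\int_0^T d^2(S(s+t)x,y)\,dt$. The orbit $\{S(t)x\}$ is called almost convergent to $z\in\mathscr{H}$ if $\sigma_T^s(x)$ converges to $z$ as $T\to\infty$ uniformly in $s\geq 0$, i.e. $\lim_{T\to\infty}\sup_{s\geq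 0}d(\sigma_T^s(x),z)=0$. *)

(* Defs.v *)
From HB Require Import structures.
From mathcomp Require Import all_boot all_order all_algebra.
From mathcomp Require Import all_classical all_reals all_analysis.

Set Implicit Arguments.
Unset Strict Implicit.
Unset Printing Implicit Defensive.

Import Order.TTheory GRing.Theory Num.Theory.
Import numFieldNormedType.Exports.

Local Open Scope classical_set_scope.
Local Open Scope ring_scope.

#[short(type="completeMetricType")]
HB.structure Definition CompleteMetric (R : numDomainType) :=
  {T of Metric R T & Complete T}.

Section Geodesics.
Context {R : realType}.

Definition geodesic (H : metricType R) (x y : H) (c : R -> H) : Prop :=
  [/\ c 0 = x, c (mdist x y) = y &
      {in `[0, mdist x y] &, forall s t, mdist (c s) (c t) = `|s - t|}].

Definition geodesic_space (H : metricType R) : Prop :=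
  forall x y : H, exists c, geodesic x y c.

(* The library's norm on row vectors is the sup norm, hence this definition. *)
Definition euclid_dist (n : nat) (u v : 'rV[R]_n) : R :=
  Num.sqrt (\sum_(k < n) (u 0 k - v 0 k) ^+ 2).

(* The point at distance s from u on the segment [u, v] of length l; when
   l = 0 the division by zero is harmless, as then u = v. *)
Definition comparison_point (n : nat) (u v : 'rV[R]_n) (l s : R) : 'rV[R]_n :=
  u + (s / l) *: (v - u).

(* Comparison triangles in the Euclidean plane.  The vertices p i of a geodesic
   triangle are indexed cyclically: side i joins p i to p (ordS i). *)
Definition CAT0 (H : metricType R) : Prop :=
  geodesic_space H /\
  forall (p : 'I_3 -> H) (c : 'I_3 -> R -> H) (q : 'I_3 -> 'rV[R]_2),
    (forall i, geodesic (p i) (p (ordS i)) (c i)) ->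
    (forall i, euclid_dist (q i) (q (ordS i)) = mdist (p i) (p (ordS i))) ->
    let cmp i := comparison_point (q i) (q (ordS i))
                   (mdist (p i) (p (ordS i))) in
    forall i j s t,
      s \in `[0, mdist (p i) (p (ordS i))] ->
      t \in `[0, mdist (p j) (p (ordS j))] ->
      mdist (c i s) (c j t) <= euclid_dist (cmp i s) (cmp j t).

Definition geodesically_convex (H : metricType R) (C : set H) : Prop :=
  forall x y c, C x -> C y -> geodesic x y c ->
    forall t, t \in `[0, mdist x y] -> C (c t).

End Geodesics.

Section Semigroups.
Context {R : realType} {H : metricType R}.

(* S t is a total map on H; only its values on C for t >= 0 are meaningful. *)
Definition nonexpansive_semigroup (C : set H) (S : R -> H -> H) : Prop :=
  [/\ forall t x, 0 <= t -> C x -> C (S t x),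
      forall x, C x -> S 0 x = x,
      forall t s x, 0 <= t -> 0 <= s -> C x -> S (t + s) x = S t (S s x),
      forall x, C x -> {within `[0, +oo[, continuous (fun t => S t x)} &
      forall t x y, 0 <= t -> C x -> C y ->
        mdist (S t x) (S t y) <= mdist x y].

Definition fixed_points (C : set H) (f : H -> H) : set H :=
  [set x | C x /\ f x = x].

Definition common_fixed_points (C : set H) (S : R -> H -> H) : set H :=
  \bigcap_(t in `[0, +oo[) fixed_points C (S t).

Definition mean_sq_dist (S : R -> H -> H) (x : H) (T s : R) (y : H) : R :=
  T^-1 * \int[lebesgue_measure]_(t in `[0, T]) (mdist (S (s + t) x) y ^+ 2).

Definition minimizers (f : H -> R) : set H :=
  [set y | forall z, f y <= f z].

(* In a Hadamard space, mean_sq_dist S x T s has exactly one minimizer for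
   T > 0, s >= 0 and x in C; the value x is a dummy for the other cases. *)
Definition sigma (S : R -> H -> H) (x : H) (T s : R) : H :=
  xget x (minimizers (mean_sq_dist S x T s)).

Definition almost_convergent (S : R -> H -> H) (x z : H) : Prop :=
  ereal_sup [set (mdist (sigma S x T s) z)%:E | s in `[0, +oo[]
    @[T --> +oo] --> 0%E.

End Semigroups.

(* Main.v *)
Require Import Defs.
From HB Require Import structures.
From mathcomp Require Import all_boot all_order all_algebra.
From mathcomp Require Import all_classical all_reals all_analysis.
From mathcomp Require Import ring lra.

Set Implicit Arguments.
Unset Strict Implicit.
Unset Printing Implicit Defensive.

Import Order.TTheory GRing.Theory Num.Theory.
Import numFieldNormedType.Exports.

Local Open Scope classical_set_scope.
Local Open Scope ring_scope.

(** The orbit u(t) = S(t) x stays in a ball around a common fixed point q, and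
in a complete, locally compact geodesic space balls are totally bounded
([totally_bounded_ball], the Hopf-Rinow theorem).  Hence, given e > 0, there is
L such that every u(t) is e-close to some u(t') with t' <= L; as the S(r) are
nonexpansive, the shifted orbits r |-> u(t + r) and r |-> u(t' + r) then stay
e-close for ever.

Consequently the means over [s, s + T] of a function t |-> d(u(t), y)^2 hardly
depend on s: replacing s by s' <= L costs a multiple of e, and replacing s' by 0
costs O(L / T).  Cutting a long window into windows of length T shows that the
means have a limit F(y) as T -> oo, uniformly in s, and uniformly in y on
bounded sets ([uniform_mean], [mean_sq_dist_limit]).

Both F and the means themselves are averages of the functions d(a, .)^2 with a
in C, in the sense of [sqdist_average].  In a CAT(0) space each d(a, .)^2 is
strongly convex along geodesics ([CAT0_sqdist_geodesic]), hence so is every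
average g of them: g has a minimizer z, it obeys d(y, z)^2 <= g(y) - g(z), and
z lies in C because the metric projection to C does not increase the distance
to any point of C ([sqdist_average_minimizer_in]).

Let z be the minimizer of F.  Shifting the window by t gives F(S(t) z) <= F(z)
([mean_sq_dist_shift]), so S(t) z = z by the displayed inequality.  The same
inequality turns the uniform closeness of the means to F into closeness of
their minimizers sigma_T^s to z, uniformly in s, which is almost convergence. *)

(** * Strong convexity of the squared distance *)

Section CAT0_inequality.
Context {R : realType}.

(** Existence of a comparison triangle in coordinates: the side of length [l]
lies on the first axis, and [(a, h)] is the opposite vertex. *)
Lemma comparison_apex (l b c : R) : 0 < l -> 0 <= b -> 0 <= c ->
  l <= b + c -> b <= l + c -> c <= l + b ->
  exists a h, a ^+ 2 + h ^+ 2 = b ^+ 2 /\ (l - a) ^+ 2 + h ^+ 2 = c ^+ 2.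
Proof.
move=> l0 b0 c0 lbc blc clb.
(* law of cosines *)
pose a := (b ^+ 2 + l ^+ 2 - c ^+ 2) / (2 * l).
have aE : a * (2 * l) = b ^+ 2 + l ^+ 2 - c ^+ 2.
  by rewrite /a divfK// mulf_neq0// gt_eqF.
have ab : a <= b by rewrite -(ler_pM2r (_ : 0 < 2 * l)) ?aE; nra.
have Nba : - b <= a by rewrite -(ler_pM2r (_ : 0 < 2 * l)) ?aE; nra.
exists a, (Num.sqrt (b ^+ 2 - a ^+ 2)); rewrite sqr_sqrtr; last by nra.
split; first by ring.
by rewrite sqrrB; lra.
Qed.

Let plane_point (a h : R) : 'rV[R]_2 := \row_j (if j == 0 then a else h).

Let euclid_dist_plane (a h a' h' : R) :
  euclid_dist (plane_point a h) (plane_point a' h') =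
  Num.sqrt ((a - a') ^+ 2 + (h - h') ^+ 2).
Proof. by rewrite /euclid_dist !big_ord_recl big_ord0 !mxE/= addr0. Qed.

(** For Euclidean segments this is an equality, which the comparison of the
geodesic triangle x, y, a with a plane triangle turns into an inequality. *)
Lemma CAT0_sqdist_geodesic (H : metricType R) (x y a : H) (c : R -> H) (t : R) :
  CAT0 H -> geodesic x y c -> 0 <= t <= 1 ->
  mdist a (c (t * mdist x y)) ^+ 2 <=
  (1 - t) * mdist a x ^+ 2 + t * mdist a y ^+ 2
  - t * (1 - t) * mdist x y ^+ 2.
Proof.
move=> [geoH catH] cxy /andP[t0 t1].
have [c0 _ _] := cxy.
have [xy|] := eqVneq x y.
  by rewrite -xy mdistxx mulr0 c0; lra.
rewrite -mdist_gt0 => l0.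
have [c1 c1ya] := geoH y a; have [c2 c2ax] := geoH a x.
have [q1 [q2 [qb qc]]] : exists u h, u ^+ 2 + h ^+ 2 = mdist a x ^+ 2 /\
    (mdist x y - u) ^+ 2 + h ^+ 2 = mdist a y ^+ 2.
  apply: comparison_apex => //; rewrite ?mdist_ge0//.
  - by rewrite [mdist a x]metric_sym metric_triangle.
  - by rewrite addrC [mdist x y]metric_sym metric_triangle.
  - by rewrite addrC metric_triangle.
pose p (i : 'I_3) := nth a [:: x; y; a] i.
pose g (i : 'I_3) := nth c [:: c; c1; c2] i.
pose q (i : 'I_3) := nth 0 [:: plane_point 0 0; plane_point (mdist x y) 0;
  plane_point q1 q2] i.
have gp i : geodesic (p i) (p (ordS i)) (g i) by case: i => [[|[|[|]]]].
have qp i : euclid_dist (q i) (q (ordS i)) = mdist (p i) (p (ordS i)).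
  case: i => [[|[|[|]]]] //= ?; rewrite /q /p/= euclid_dist_plane.
  - by rewrite subrr expr0n/= addr0 add0r sqrrN sqrtr_sqr ger0_norm ?mdist_ge0.
  - by rewrite sub0r sqrrN qc sqrtr_sqr ger0_norm ?mdist_ge0// metric_sym.
  - by rewrite !subr0 qb sqrtr_sqr ger0_norm ?mdist_ge0.
(* the vertex a is the starting point of side 2 *)
have := catH p g q gp qp ord0 (inord 2) (t * mdist x y) 0.
rewrite /p /g /q /= inordK//= !in_itv/= !lexx !mdist_ge0/=.
rewrite mulr_ge0 ?mdist_ge0// ler_piMl ?mdist_ge0// => /(_ isT isT).
have [-> _ _] := c2ax.
rewrite /comparison_point mul0r scale0r addr0 mulfK ?gt_eqF//.
have -> : plane_point 0 0 + t *: (plane_point (mdist x y) 0 - plane_point 0 0)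
    = plane_point (t * mdist x y) 0.
  by apply/rowP => j; rewrite !mxE; case: ifP => _; ring.
rewrite metric_sym euclid_dist_plane.
set E := (X in Num.sqrt X) => h.
have E0 : 0 <= E by rewrite addr_ge0 ?sqr_ge0.
have -> : (1 - t) * mdist a x ^+ 2 + t * mdist a y ^+ 2
    - t * (1 - t) * mdist x y ^+ 2 = E by rewrite /E -qb -qc; ring.
by rewrite -(sqr_sqrtr E0) lerXn2r// nnegrE ?sqrtr_ge0 ?mdist_ge0.
Qed.

End CAT0_inequality.

(** * Averages of squared distances and their minimizers *)

Section SqdistAverages.
Context {R : realType} {H : completeMetricType R}.
Implicit Types (A K : set H) (g : H -> R).

(** By duality, the pointwise closed convex hull of the functions d(a, .)^2,
a in A.  This form passes to integral means and to pointwise limits at no cost,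
and it yields each property of g below by instantiation at at most three
points. *)
Definition sqdist_average A g : Prop :=
  forall (k : R) (w : seq (R * H)),
    (forall a, A a -> 0 <= k + \sum_(i <- w) i.1 * mdist a i.2 ^+ 2) ->
    0 <= k + \sum_(i <- w) i.1 * g i.2.

Lemma sqdist_average1 (a : H) :
  sqdist_average [set a] (fun y => mdist a y ^+ 2).
Proof. by move=> k w; apply. Qed.

Lemma sqdist_average_cvg A (g : nat -> H -> R) (G : H -> R) :
  (forall n, sqdist_average A (g n)) ->
  (forall y, g n y @[n --> \oo] --> G y) ->
  sqdist_average A G.
Proof.
move=> gA gG k w kw.
have : k + \sum_(i <- w) i.1 * g n i.2 @[n --> \oo] -->
       k + \sum_(i <- w) i.1 * G i.2.
  apply: cvgD; first exact: cvg_cst.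
  elim: w {kw} => [|i w IH].
    by under eq_fun do rewrite big_nil; rewrite big_nil; exact: cvg_cst.
  under eq_fun do rewrite big_cons; rewrite big_cons.
  by apply: cvgD IH; apply: cvgM (gG _); exact: cvg_cst.
move=> h; rewrite -(cvg_lim _ h)//; apply: limr_ge.
  by apply/cvg_ex; eexists; exact: h.
by near=> n; apply: gA.
Unshelve. all: by end_near. Qed.

Lemma sqdist_average_ge0 A g y : sqdist_average A g -> 0 <= g y.
Proof.
move=> /(_ 0 [:: (1, y)]); rewrite !big_cons !big_nil/= mul1r !addr0 add0r.
apply=> a _; rewrite !big_cons !big_nil/= mul1r !addr0 add0r.
exact: sqr_ge0.
Qed.

Lemma sqdist_average_le A g y y' :
  (forall a, A a -> mdist a y <= mdist a y') -> sqdist_average A g ->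
  g y <= g y'.
Proof.
move=> yy' /(_ 0 [:: (1, y'); (-1, y)]).
rewrite !big_cons !big_nil/= => h; rewrite -subr_ge0.
have -> : g y' - g y = 0 + (1 * g y' + (-1 * g y + 0)) by ring.
apply: h => a Aa; rewrite !big_cons !big_nil/=.
have := yy' a Aa; rewrite -(ler_pXn2r (_ : 0 < 2)%N) ?nnegrE ?mdist_ge0// => ?.
lra.
Qed.

(** Stands in for continuity; unlike a Lipschitz estimate, whose constant would
depend on the base point a, it is affine in the squared distances, so averages
inherit it. *)
Lemma sqdist_average_perturb A g y y' (e : R) : 0 < e ->
  sqdist_average A g ->
  g y <= (1 + e) * g y' + (1 + e^-1) * mdist y y' ^+ 2.
Proof.
move=> e0 /(_ ((1 + e^-1) * mdist y y' ^+ 2) [:: (1 + e, y'); (-1, y)]).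
rewrite !big_cons !big_nil/= => h; rewrite -subr_ge0.
rewrite [X in 0 <= X](_ : _ = (1 + e^-1) * mdist y y' ^+ 2 +
  ((1 + e) * g y' + (-1 * g y + 0))); last by ring.
apply: h => a Aa; rewrite !big_cons !big_nil/=.
have := metric_triangle a y' y; rewrite [mdist y' y]metric_sym.
move: (mdist_ge0 a y) (mdist_ge0 a y') (mdist_ge0 y y').
move: (mdist a y) (mdist a y') (mdist y y') => u v d u0 v0 d0 uvd.
have u2 : u ^+ 2 <= (v + d) ^+ 2 by rewrite lerXn2r// nnegrE addr_ge0.
rewrite -subr_ge0 in u2.
(* Young's inequality 2 v d <= e v^2 + d^2 / e *)
have : 0 <= (e * v - d) ^+ 2 * e^-1 by rewrite mulr_ge0 ?sqr_ge0// invr_ge0 ltW.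
have -> : (e * v - d) ^+ 2 * e^-1 = e * v ^+ 2 - 2 * v * d + e^-1 * d ^+ 2.
  by field; rewrite gt_eqF.
lra.
Qed.

Lemma sqdist_average_geodesic A g (x y : H) (c : R -> H) (t : R) :
  CAT0 H -> geodesic x y c -> 0 <= t <= 1 -> sqdist_average A g ->
  g (c (t * mdist x y)) <=
  (1 - t) * g x + t * g y - t * (1 - t) * mdist x y ^+ 2.
Proof.
move=> catH cxy t01; set m := c _.
move=> /(_ (- (t * (1 - t) * mdist x y ^+ 2))
  [:: (1 - t, x); (t, y); (-1, m)]) h.
rewrite -subr_ge0 [X in 0 <= X](_ : _ = - (t * (1 - t) * mdist x y ^+ 2) +
  \sum_(i <- [:: (1 - t, x); (t, y); (-1, m)]) i.1 * g i.2); last first.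
  by rewrite !big_cons big_nil/=; ring.
apply: h => a _; rewrite !big_cons big_nil/=.
have := CAT0_sqdist_geodesic a catH cxy t01; rewrite -/m; lra.
Qed.

Lemma ler_vanishing (a b c : R) :
  (forall t, 0 < t -> t <= 1 -> a <= b + t * c) -> a <= b.
Proof.
move=> h; apply/ler_addgt0Pr => e e0.
have c0 : 0 < `|c| + 1 by rewrite ltr_wpDl.
pose t := Num.min 1 (e / (`|c| + 1)).
have t0 : 0 < t by rewrite lt_min ltr01 divr_gt0.
have t1 : t <= 1 by rewrite ge_min lexx.
apply: (le_trans (h t t0 t1)); rewrite lerD2l.
apply: (@le_trans _ _ (t * (`|c| + 1))).
  by rewrite ler_pM2l//; have := ler_norm c; lra.
by rewrite -ler_pdivlMr// ge_min lexx orbT.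
Qed.

(** By strong convexity at midpoints, almost minimizing points are close to each
other, so that they converge.  Strong convexity along the geodesic from the
minimizer to [y], close to the minimizer, then gives the sharp constant 1 in
the quadratic growth; [sqdist_average_minimizer_in] relies on that constant. *)
Lemma sqdist_average_minimizer A K g : CAT0 H -> closed K ->
  geodesically_convex K -> K !=set0 -> sqdist_average A g ->
  exists2 z, K z & forall y, K y -> mdist y z ^+ 2 <= g y - g z.
Proof.
move=> catH clK cvxK [y0 Ky0] gA.
have [geoH _] := catH.
have g0 y : 0 <= g y by exact: sqdist_average_ge0 gA.
pose m := inf (g @` K).
have infK : has_inf (g @` K).
  by split; [exists (g y0), y0|exists 0 => _ [y _ <-]].
have mg y : K y -> m <= g y by move=> Ky; apply: ge_inf; [case: infK|exists y].
have midK x y : K x -> K y -> mdist x y ^+ 2 <= 2 * (g x + g y - 2 * m).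
  move=> Kx Ky; have [c cxy] := geoH x y.
  have half01 : 0 <= (2^-1 : R) <= 1 by apply/andP; split; lra.
  have := sqdist_average_geodesic catH cxy half01 gA.
  have Km : K (c (2^-1 * mdist x y)).
    apply: cvxK cxy _ _ => //; rewrite in_itv/= mulr_ge0 ?mdist_ge0//=.
    by rewrite ler_piMl ?mdist_ge0//; lra.
  by have := mg _ Km; lra.
(* the filter of minimizing sequences *)
pose F :=
  filter_from [set e : R | 0 < e] (fun e => [set y | K y /\ g y < m + e]).
have FF : ProperFilter F.
  apply: filter_from_proper => [|e e0].
    apply: filter_from_filter => [|i j i0 j0]; first by exists 1 => /=.
    exists (Num.min i j); first by rewrite /= lt_min i0.
    by move=> y [Ky]; rewrite /= -ltrBlDl lt_min !ltrBlDl => /andP[].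
  have [_ [y Ky <-] gy] := inf_adherent e0 infK.
  by exists y.
have /cauchy_cvg/cvg_ex[z Fz] : cauchy F.
  apply/cauchy_exP => e e0.
  have d0 : 0 < e ^+ 2 / 4 by rewrite divr_gt0// exprn_gt0.
  have [_ [x Kx <-] gx] := inf_adherent d0 infK.
  exists x, (e ^+ 2 / 4) => // y [Ky gy].
  rewrite ballEmdist/= -(ltr_pXn2r (_ : 0 < 2)%N) ?nnegrE ?mdist_ge0 ?ltW//.
  by have := midK _ _ Kx Ky; rewrite -/m in gx; lra.
have Kz : K z.
  apply: clK => U /Fz [e e0 eU]; have [_ [y Ky <-] gy] := inf_adherent e0 infK.
  by exists y; split => //; apply: eU.
have m0 : 0 <= m by apply: lb_le_inf => [|_ [y _ <-]//]; case: infK.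
have gz : g z = m.
  apply/eqP; rewrite eq_le mg// andbT; apply: (ler_vanishing (c := m + 4)).
  move=> e e0 e1.
  (* y is e^2-close to z, so that the term in 1 / e is still O(e) *)
  have [d /= d0 dy] : F (ball z (e ^+ 2)).
    by apply: Fz; apply: nbhsx_ballx; rewrite exprn_gt0.
  have de0 : 0 < Num.min d e by rewrite lt_min d0.
  have [_ [y Ky <-] gy] := inf_adherent de0 infK.
  rewrite -/m -ltrBlDl lt_min !ltrBlDl in gy.
  have /andP[gyd gye] := gy.
  have := dy y (conj Ky gyd); rewrite ballEmdist/= => zy.
  apply: (le_trans (sqdist_average_perturb z y e0 gA)).
  apply: (@le_trans _ _ ((1 + e) * (m + e) + (1 + e^-1) * e ^+ 4)).
    apply: lerD; first by rewrite ler_pM2l ?ltW//; lra.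
    rewrite ler_pM2l; last by rewrite ltr_wpDr ?invr_ge0 ?ltW.
    rewrite (_ : 4 = 2 * 2)%N// exprM.
    by rewrite lerXn2r ?nnegrE ?mdist_ge0 ?exprn_ge0 ?ltW.
  have -> : (1 + e^-1) * e ^+ 4 = e ^+ 4 + e ^+ 3.
    by field; rewrite gt_eqF.
  have : e ^+ 2 <= e by rewrite ler_iXnr// ltW.
  have : e ^+ 3 <= e by rewrite ler_iXnr// ltW.
  have : e ^+ 4 <= e by rewrite ler_iXnr// ltW.
  lra.
exists z => // y Ky.
have [c czy] := geoH z y.
apply: (ler_vanishing (c := mdist y z ^+ 2)) => t t0 t1.
have t01 : 0 <= t <= 1 by rewrite t1 ltW.
have := sqdist_average_geodesic catH czy t01 gA.
have : m <= g (c (t * mdist z y)).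
  apply/mg/(cvxK _ _ _ Kz Ky czy); rewrite in_itv/=.
  by rewrite ler_piMl ?mdist_ge0// mulr_ge0 ?mdist_ge0// ltW.
rewrite -gz [mdist z y]metric_sym => h1 h2.
rewrite -(ler_pM2l t0); lra.
Qed.

(** Let p be the projection of the global minimizer z to A.  The growth estimate
for d(z, .)^2 on A says that p is at least as close as z to each point of A, so
g(p) <= g(z), and p = z. *)
Lemma sqdist_average_minimizer_in A g : CAT0 H -> closed A ->
  geodesically_convex A -> A !=set0 -> sqdist_average A g ->
  exists2 z, A z & forall y, mdist y z ^+ 2 <= g y - g z.
Proof.
move=> catH clA cvxA A0 gA.
have [z _ zmin] : exists2 z, setT z &
    forall y, setT y -> mdist y z ^+ 2 <= g y - g z.
  apply: (sqdist_average_minimizer catH _ _ _ gA); first exact: closedT.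
    by [].
  by case: A0 => a _; exists a.
exists z => [|y]; last exact: zmin.
have [p Ap pmin] := sqdist_average_minimizer catH clA cvxA A0
  (@sqdist_average1 z).
have gpz : g p <= g z.
  apply: sqdist_average_le gA => a Aa.
  rewrite -(ler_pXn2r (_ : 0 < 2)%N) ?nnegrE ?mdist_ge0//.
  rewrite [mdist a z]metric_sym.
  by apply: (le_trans (pmin a Aa)); rewrite gerBl sqr_ge0.
suff <- : p = z by [].
apply: mdist_positivity; apply/eqP; rewrite -sqrf_eq0 eq_le sqr_ge0 andbT.
by apply: (le_trans (zmin p I)); rewrite subr_le0.
Qed.

End SqdistAverages.

(** * Integrals of continuous functions over translated intervals *)

Section Means.
Context {R : realType}.
Implicit Types (f : R -> R).
Local Notation mu := (@lebesgue_measure R).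

Definition window f (T s : R) : R := \int[mu]_(t in `[0, T]) f (s + t).

Lemma continuous_integrable_itv f (a b : R) : continuous f ->
  mu.-integrable `[a, b] (EFin \o f).
Proof.
move=> cf; apply: continuous_compact_integrable; first exact: segment_compact.
exact: continuous_subspaceT.
Qed.

Lemma continuous_translate f (s : R) : continuous f ->
  continuous (fun t => f (s + t)).
Proof.
move=> cf t; apply: (continuous_comp (f := fun t => s + t)).
  by apply: cvgD; [exact: cvg_cst|exact: cvg_id].
exact: cf.
Qed.

Lemma window_integrable f (T s : R) : continuous f ->
  mu.-integrable `[0, T] (EFin \o (fun t => f (s + t))).
Proof. by move=> cf; apply/continuous_integrable_itv/continuous_translate. Qed.

Lemma window_itv f (T s : R) : continuous f -> 0 <= T ->
  window f T s = \int[mu]_(t in `[s, s + T]) f t.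
Proof.
move=> cf T0; rewrite /window /Rintegral.
have dE : derive1 (fun t : R => s + t) = cst 1.
  apply/funext => t; rewrite derive1E deriveD// derive_cst derive_id add0r//.
have cT : continuous (fun t : R => s + t).
  by move=> t; apply: cvgD; [exact: cvg_cst|exact: cvg_id].
have := @integration_by_substitution_increasing R (fun t => s + t) f 0 T T0.
rewrite dE addr0 => -> //.
- by congr fine; apply: eq_integral => t _ /=; rewrite mulr1.
- by move=> x y _ _; rewrite ltrD2l.
- by move=> t _; exact: cvg_cst.
- exact: is_cvg_cst.
- exact: is_cvg_cst.
- split=> [t _| |].
  + by apply: derivableD.
  + rewrite addr0; apply: cvg_at_right_filter.
    by have := cT 0; rewrite /continuous_at addr0.
  + by apply: cvg_at_left_filter; exact: cT.
- exact: continuous_subspaceT.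
Qed.

Lemma windowD f (T T' s : R) : continuous f -> 0 <= T -> 0 <= T' ->
  window f (T + T') s = window f T s + window f T' (s + T).
Proof.
move=> cf T0 T'0; rewrite !window_itv ?addr_ge0// addrA.
apply/eqP; rewrite -(inj_eq (addrI (- \int[mu]_(t in `[s, s + T]) f t))) addKr.
apply/eqP; rewrite [LHS]addrC Rintegral_itvB.
- rewrite Rintegral_itv_obnd_cbnd//.
  apply: integrableS (continuous_integrable_itv (s + T) (s + T + T') cf) => //.
  by apply: subset_itvr; rewrite bnd_simp.
- exact: continuous_integrable_itv.
- by rewrite bnd_simp lerDl.
- by rewrite bnd_simp lerDl.
Qed.

Lemma ler_window f g (T s : R) : continuous f -> continuous g ->
  (forall t, 0 <= t -> f (s + t) <= g (s + t)) -> window f T s <= window g T s.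
Proof.
move=> cf cg fg; apply: le_Rintegral => //; try exact: window_integrable.
by move=> t /=; rewrite in_itv/= => /andP[t0 _]; exact: fg.
Qed.

Lemma window_cst (k T s : R) : 0 <= T -> window (cst k) T s = k * T.
Proof.
move=> T0; rewrite /window Rintegral_cst//= lebesgue_measure_itv/= lte_fin.
by move: T0; rewrite le_eqVlt => /predU1P[<-|->]; rewrite ?ltxx/= ?subr0.
Qed.

End Means.

(** * Uniform means of recurrent functions *)

Section UniformMean.
Context {R : realType}.
Implicit Types (f : R -> R).

Lemma window_affine (I : Type) (w : seq I) (h : I -> R -> R) (k T s : R) :
  (forall i, continuous (h i)) -> 0 <= T ->
  continuous (fun t => k + \sum_(i <- w) h i t) /\
  window (fun t => k + \sum_(i <- w) h i t) T s =
  k * T + \sum_(i <- w) window (h i) T s.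
Proof.
move=> ch T0.
elim: w => [|i w [cw IH]].
  under eq_fun do rewrite big_nil addr0; rewrite big_nil addr0.
  by split; [move=> ?; exact: cvg_cst|exact: window_cst].
have E : (fun t => k + \sum_(j <- i :: w) h j t) =
    (fun t => h i t + (k + \sum_(j <- w) h j t)).
  by apply/funext => t; rewrite big_cons addrCA.
rewrite E big_cons addrCA -IH; split.
  by move=> t; apply: cvgD; [exact: ch|exact: cw].
rewrite /window RintegralD//; [exact: (window_integrable _ _ (ch i))|].
exact: (window_integrable _ _ cw).
Qed.

Lemma windowZ f (a T s : R) : continuous f ->
  window (fun t => a * f t) T s = a * window f T s.
Proof.
by move=> cf; rewrite /window RintegralZl//; exact: (window_integrable _ _ cf).
Qed.

(** Up to the error [e], every future of [f] is a future from a time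
between 0 and [L]: the trace of a relatively compact orbit of nonexpansive
maps. *)
Definition almost_recurrent f (e L : R) : Prop :=
  0 <= L /\ forall t, 0 <= t -> exists2 t', 0 <= t' <= L &
    forall r, 0 <= r -> `|f (t + r) - f (t' + r)| <= e.

Variables (f : R -> R) (B : R).
Hypotheses (cf : continuous f) (f0B : forall t, 0 <= t -> 0 <= f t <= B).

Let window_bounds (T s : R) : 0 <= T -> 0 <= s -> 0 <= window f T s <= B * T.
Proof.
move=> T0 s0; rewrite -(window_cst B s T0) -[X in X <= _ <= _](mul0r T).
rewrite -(window_cst 0 s T0).
have ccst (k : R) : continuous (cst k : R -> R) by move=> ?; exact: cvg_cst.
apply/andP; split; apply: ler_window => // t t0;
  by have /andP[] := f0B (addr_ge0 s0 t0).
Qed.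

Let window_shift (T s : R) : 0 <= T -> 0 <= s ->
  `|window f T s - window f T 0| <= B * s.
Proof.
move=> T0 s0.
have := windowD 0 cf s0 T0; rewrite addrC (windowD 0 cf T0 s0) !add0r.
have := window_bounds s0 T0; have := window_bounds s0 (lexx 0).
move=> /andP[? ?] /andP[? ?] ?; rewrite ler_norml; apply/andP; split; lra.
Qed.

(** The window at [s] is compared to a window at some [s' <= L], whose integral
differs from that of the window at 0 by integrals over the two pieces [0, s']
and [T, T + s'] of length [s']. *)
Let window_recurrent (e L T s : R) : almost_recurrent f e L ->
  0 <= T -> 0 <= s -> `|window f T s - window f T 0| <= e * T + B * L.
Proof.
move=> [L0 fL] T0 s0; have [s' /andP[s'0 s'L] ss'] := fL s s0.
have B0 : 0 <= B by have /andP[] := f0B (lexx 0); exact: le_trans.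
have ccst (k : R) : continuous (cst k : R -> R) by move=> ?; exact: cvg_cst.
have h (a b : R) : (forall r, 0 <= r -> `|f (a + r) - f (b + r)| <= e) ->
    window f T a <= e * T + window f T b.
  move=> ab; pose g t := f (t + (b - a)).
  have cg : continuous g.
    have := continuous_translate (s := b - a) cf.
    by under eq_fun do rewrite addrC.
  have -> : window f T b = window g T a.
    by rewrite /window; apply: eq_Rintegral => t _; congr f; ring.
  rewrite -(window_cst e a T0) /window -RintegralD//; last 2 first.
  - exact: (window_integrable _ _ (ccst e)).
  - exact: (window_integrable _ _ cg).
  have ceg : continuous (cst e \+ g).
    by move=> t; apply: cvgD; [exact: cvg_cst|exact: cg].
  apply: le_Rintegral => //.
  - exact: (window_integrable _ _ cf).
  - exact: (window_integrable _ _ ceg).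
  - move=> t /=; rewrite in_itv/= => /andP[t0 _]; have := ab t t0.
    rewrite /g (_ : a + t + (b - a) = b + t) ?ler_norml; last by ring.
    by move=> /andP[_]; rewrite lerBlDr.
have h1 := h _ _ ss'.
have h2 : window f T s' <= e * T + window f T s.
  by apply: h => r r0; rewrite distrC; exact: ss'.
have := window_shift T0 s'0.
have : B * s' <= B * L by rewrite ler_wpM2l.
rewrite !ler_norml => ? /andP[? ?]; apply/andP; split; lra.
Qed.

Let window_mulrn (e L T : R) (n : nat) : almost_recurrent f e L -> 0 <= T ->
  `|window f (n%:R * T) 0 - n%:R * window f T 0| <= n%:R * (e * T + B * L).
Proof.
move=> fL T0; elim: n => [|n IH].
  have /andP[] := window_bounds (lexx 0) (lexx 0).
  rewrite mulr0 !mul0r subr0 => ? ?; rewrite ler_norml; apply/andP; split; lra.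
have nT0 : 0 <= n%:R * T by rewrite mulr_ge0.
rewrite -natr1 !mulrDl !mul1r windowD// add0r.
have := window_recurrent fL T0 nT0; move: IH; rewrite !ler_norml.
move=> /andP[? ?] /andP[? ?]; apply/andP; split; lra.
Qed.

(** The window of length [T'] consists of [n] windows of length [T], each
close to the first one by recurrence, and of a rest shorter than [T]. *)
Let window_ratio (e L T T' : R) : almost_recurrent f e L -> 0 < T -> 0 <= T' ->
  `|T * window f T' 0 - T' * window f T 0| <=
  T' * (e * T + B * L) + 2 * B * T ^+ 2.
Proof.
move=> fL T0 T'0; pose n := Num.truncn (T' / T).
have B0 : 0 <= B by have /andP[] := f0B (lexx 0); exact: le_trans.
have /andP[nT Tn] : n%:R * T <= T' < n.+1%:R * T.
  have := truncn_itv (divr_ge0 T'0 (ltW T0)).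
  by rewrite -ler_pdivlMr// -ltr_pdivrMr.
pose r := T' - n%:R * T.
have r0 : 0 <= r by rewrite subr_ge0.
have rT : r <= T by rewrite /r; move: Tn; rewrite -natr1; lra.
have nT0 : 0 <= n%:R * T by rewrite mulr_ge0// ltW.
have T'E : T' = n%:R * T + r by rewrite /r; ring.
have d0 : 0 <= e * T + B * L.
  exact: le_trans (normr_ge0 _) (window_recurrent fL (ltW T0) (lexx 0)).
have -> : window f T' 0 = window f (n%:R * T) 0 + window f r (n%:R * T).
  by rewrite {1}T'E windowD// add0r.
have /andP[a1 a2] := window_bounds r0 nT0.
have /andP[b1 b2] := window_bounds (ltW T0) (lexx 0).
have c := window_mulrn n fL (ltW T0).
have rB : B * r <= B * T by rewrite ler_wpM2l.
set A := window f r _ in a1 a2 *; set W := window f T 0 in b1 b2 c *.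
set V := window f _ 0 in c *; set d := e * T + B * L in d0 c *.
have -> : T * (V + A) - T' * W = T * (V - n%:R * W) + T * A - r * W.
  by rewrite T'E; ring.
apply: le_trans (ler_normB _ _) _.
apply: le_trans (lerD (ler_normD _ _) (lexx _)) _.
have -> : 2 * B * T ^+ 2 = T * (B * T) + T * (B * T) by ring.
rewrite addrA !normrM (ger0_norm (ltW T0)) (ger0_norm a1) (ger0_norm b1).
rewrite (ger0_norm r0) !lerD//.
- apply: le_trans (_ : T * (n%:R * d) <= _); first by rewrite ler_pM2l.
  by rewrite mulrA ler_wpM2r// mulrC.
- by rewrite ler_pM2l// (le_trans a2).
- by rewrite ler_pM// ltW.
Qed.

(** The error is explicit, so that it is uniform over any family of functions
that share [B], [e] and [L].  By [window_ratio] with T' -> oo, the intervals of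
radius e + B L / T around the means over [0, T] intersect pairwise, whatever
the admissible e, L and T are; [m] is a common point, the supremum of the lower
ends. *)
Lemma uniform_mean : exists m, forall e L, almost_recurrent f e L ->
  forall T s, 0 < T -> 0 <= s ->
    `|T^-1 * window f T s - m| <= 2 * (e + B * L / T).
Proof.
have B0 : 0 <= B by have /andP[] := f0B (lexx 0); exact: le_trans.
pose M T := T^-1 * window f T 0.
have compare e1 L1 T1 e2 L2 T2 :
    almost_recurrent f e1 L1 -> almost_recurrent f e2 L2 -> 0 < T1 -> 0 < T2 ->
    M T1 - (e1 + B * L1 / T1) <= M T2 + (e2 + B * L2 / T2).
  move=> fL1 fL2 T10 T20; apply/ler_addgt0Pr => h h0.
  pose T' := 2 * B * (T1 + T2) / h + 1.
  have T'0 : 0 < T'.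
    by rewrite ltr_wpDl// divr_ge0 ?(ltW h0)// !mulr_ge0 ?addr_ge0// ltW.
  have near_T' e L T : almost_recurrent f e L -> 0 < T ->
      `|M T' - M T| <= (e + B * L / T) + 2 * B * T / T'.
    move=> fL T0; have := window_ratio fL T0 (ltW T'0).
    have -> : M T' - M T =
        (T * T')^-1 * (T * window f T' 0 - T' * window f T 0).
      by rewrite /M; field; rewrite !gt_eqF.
    have TT'0 : 0 < (T * T')^-1 by rewrite invr_gt0 mulr_gt0.
    rewrite normrM (gtr0_norm TT'0) -(ler_pM2l TT'0) => /le_trans; apply.
    by rewrite le_eqVlt; apply/orP; left; apply/eqP; field; rewrite !gt_eqF.
  have : 2 * B * T1 / T' + 2 * B * T2 / T' <= h.
    rewrite -mulrDl -mulrDr ler_pdivrMr// [h * _]mulrC /T' [leRHS]mulrDl.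
    by rewrite divfK ?gt_eqF// mul1r lerDl ltW.
  have := near_T' _ _ _ fL1 T10; have := near_T' _ _ _ fL2 T20.
  rewrite !ler_norml => /andP[? ?] /andP[? ?] ?; lra.
pose E := [set b | exists e L T, [/\ almost_recurrent f e L, 0 < T &
  b = M T - (e + B * L / T)]].
have f1 : almost_recurrent f B 0.
  split=> // t t0; exists 0 => [|r r0]; first by rewrite lexx.
  have /andP[? ?] := f0B (addr_ge0 t0 r0); rewrite add0r.
  by have /andP[? ?] := f0B r0; rewrite ler_norml; apply/andP; split; lra.
have Eub e L T : almost_recurrent f e L -> 0 < T ->
    ubound E (M T + (e + B * L / T)).
  by move=> fL T0 _ [e' [L' [T' [fL' T'0 ->]]]]; exact: compare.
have E0 : E !=set0 by exists (M 1 - (B + B * 0 / 1)), B, 0, 1.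
exists (sup E) => e L fL T s T0 s0.
have up : sup E <= M T + (e + B * L / T) by exact: ge_sup (Eub _ _ _ fL T0).
have lo : M T - (e + B * L / T) <= sup E.
  by apply: ub_le_sup; [eexists; exact: (Eub _ _ _ fL T0)|exists e, L, T].
have : `|T^-1 * window f T s - M T| <= e + B * L / T.
  rewrite /M -mulrBr normrM gtr0_norm ?invr_gt0// ler_pdivrMl//.
  rewrite mulrDr mulrCA divff ?gt_eqF// mulr1 mulrC.
  exact: window_recurrent (ltW T0) s0.
rewrite !ler_norml => /andP[? ?]; apply/andP; split; lra.
Qed.

End UniformMean.

(** * Total boundedness of balls: the Hopf-Rinow theorem *)

Section TotallyBounded.
Context {R : realType} {H : completeMetricType R}.
Implicit Types (A B K : set H).

Definition totally_bounded A : Prop := forall e : R, 0 < e ->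
  exists s : seq H, forall y, A y -> exists2 c, c \in s & mdist c y < e.

Lemma totally_bounded_subset A B : A `<=` B -> totally_bounded B ->
  totally_bounded A.
Proof. by move=> AB tB e /tB[s sB]; exists s => y /AB /sB. Qed.

Lemma totally_boundedU A B : totally_bounded A -> totally_bounded B ->
  totally_bounded (A `|` B).
Proof.
move=> tA tB e e0; have [s sA] := tA e e0; have [s' sB] := tB e e0.
exists (s ++ s') => y [/sA|/sB] [c cs cy]; exists c => //;
  by rewrite mem_cat cs ?orbT.
Qed.

Lemma mdist_nbhs (x : H) (e : R) : 0 < e -> nbhs x [set y | mdist x y < e].
Proof. by move=> e0; rewrite -ballEmdist; exact: nbhsx_ballx. Qed.

Lemma compact_totally_bounded K : compact K -> totally_bounded K.
Proof.
rewrite compact_cover => cK e e0.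
have [|y Ky|D _ KD] := cK H K (fun c => interior [set y | mdist c y < e]).
- by move=> ? _; exact: open_interior.
- by exists y => //; rewrite /interior; exact: mdist_nbhs.
- exists (finmap.enum_fset D) => y /KD[c cD] /interior_subset cy.
  by exists c.
Qed.

(** An ultrafilter on a totally bounded set contains one of the finitely many
balls of each cover, so it is Cauchy. *)
Lemma totally_bounded_compact K : closed K -> totally_bounded K -> compact K.
Proof.
move=> clK tK; rewrite compact_ultra => F UF FK.
have FF : ProperFilter F by apply: ultra_proper.
have /cauchy_cvg/cvg_ex[z Fz] : cauchy F.
  apply/cauchy_exP => e e0; have [s] := tK e e0; clear clK tK.
  elim: s K FK => [|c s IH] K FK sK.
    by have [y /sK[]] := filter_ex FK.
  have [Fc|Fc] := in_ultra_setVsetC (ball c e) UF; first by exists c.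
  apply: (IH _ (filterI FK Fc)) => y [/sK[c']].
  rewrite inE => /predU1P[->|c's c'y] cy; last by exists c'.
  by rewrite /= ballEmdist in cy *.
exists z; split => //; apply: clK => U /Fz FU.
exact: filter_ex (filterI FK FU).
Qed.

(** Cover K by finitely many balls of radius r_i / 2 whose doubles are totally
bounded; then any d <= min r_i / 2 will do. *)
Lemma compact_thickening K : locally_compact [set: H] -> compact K ->
  exists2 d : R, 0 < d &
    totally_bounded [set y | exists2 x, K x & mdist x y < d].
Proof.
move=> lcH; rewrite compact_cover => cK.
pose D := [set i : H * R |
  0 < i.2 /\ totally_bounded [set y | mdist i.1 y < i.2]].
have [|y Ky|F FD KF] :=
  cK _ D (fun i => interior [set y | mdist i.1 y < i.2 / 2]).
- by move=> ? _; exact: open_interior.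
- have [U + [cU _]] := lcH y I.
  rewrite /within/= => /metricType_numDomainType.nbhs_mdistP[r /= r0 rU].
  exists (y, r); last first.
    by rewrite /interior/=; apply: mdist_nbhs; rewrite divr_gt0.
  split => //=.
  apply: totally_bounded_subset (compact_totally_bounded cU) => z /=.
  by move=> /rU; exact.
suff [d d0 td] : exists2 d : R, 0 < d & totally_bounded
    [set y | exists2 i, i \in finmap.enum_fset F &
      exists2 x, mdist i.1 x < i.2 / 2 & mdist x y < d].
  exists d => //; apply: totally_bounded_subset td => y [x /KF[i iF]].
  by move=> /interior_subset ix xy; exists i => //; exists x.
have : {subset finmap.enum_fset F <= D} by [].
elim: (finmap.enum_fset F) => [_|i s IH sD].
  by exists 1 => // e _; exists [::] => y [].
have [|d d0 td] := IH; first by move=> j js; apply: sD; rewrite inE js orbT.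
have /set_mem[i0 ti] : i \in D by apply: sD; rewrite mem_head.
have i20 : 0 < i.2 / 2 by rewrite divr_gt0.
exists (Num.min d (i.2 / 2)); first by rewrite lt_min d0.
apply: totally_bounded_subset (totally_boundedU ti td) => y [j].
rewrite inE => /predU1P[->|js] [x jx]; rewrite lt_min => /andP[xd xi].
  by left => /=; apply: le_lt_trans (metric_triangle _ x _) _; lra.
by right; exists j => //; exists x.
Qed.

Lemma closed_mdist_le (a : H) (r : R) : closed [set y | mdist a y <= r].
Proof.
move=> y cly /=; apply/ler_addgt0Pr => e e0.
have [z [/= az yz]] := cly _ (mdist_nbhs y e0).
apply: le_trans (metric_triangle _ z _) _.
by rewrite [mdist z y]metric_sym lerD// ltW.
Qed.

Lemma geodesic_truncate (a y : H) (r : R) : geodesic_space H -> 0 <= r ->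
  exists2 x, mdist a x <= r & mdist x y <= Num.max 0 (mdist a y - r).
Proof.
move=> geoH r0; have [ay|/ltW ray] := leP (mdist a y) r.
  by exists y => //; rewrite mdistxx le_max lexx.
have [c [ca cy cd]] := geoH a y.
have rI : r \in `[0, mdist a y] by rewrite in_itv/= r0.
have I0 : 0 \in `[0, mdist a y] by rewrite in_itv/= lexx mdist_ge0.
have I1 : mdist a y \in `[0, mdist a y] by rewrite in_itv/= lexx mdist_ge0.
exists (c r).
  by rewrite -{1}ca (cd _ _ I0 rI) sub0r normrN ger0_norm.
by rewrite -{1}cy (cd _ _ rI I1) ler0_norm ?subr_le0// opprB le_max lexx orbT.
Qed.

(** The radii of totally bounded balls form an interval.  A finite supremum p of
it would be attained, as geodesics bring the p-ball within e / 2 of a smaller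
one; the p-ball would then be compact, and thickening it would give a larger
totally bounded ball. *)
Lemma totally_bounded_ball (a : H) (r : R) : geodesic_space H ->
  locally_compact [set: H] -> totally_bounded [set y | mdist a y <= r].
Proof.
move=> geoH lcH; pose cb r := [set y | mdist a y <= r].
pose E := [set r : R | totally_bounded (cb r)].
have E0 : E 0.
  move=> e e0; exists [:: a] => y /= ay; exists a; rewrite ?mem_head//.
  exact: le_lt_trans ay e0.
have Edown s t : s <= t -> E t -> E s.
  by move=> st; apply: totally_bounded_subset => y /= /le_trans; exact.
have [ubE|] := pselect (has_ubound E); last first.
  move=> /has_ubPn /(_ r)[t Et /ltW rt]; exact: Edown rt Et.
pose p := sup E.
have supE : has_sup E by split => //; exists 0.
have p0 : 0 <= p by exact: ub_le_sup.
have Ep : E p.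
  move=> e e0; have e20 : 0 < e / 2 by rewrite divr_gt0.
  have [t Et pt] := sup_adherent e20 supE; rewrite -/p in pt.
  have [t0|t0] := ltP t 0.
    exists [:: a] => y; rewrite /cb/= => ay; exists a; rewrite ?mem_head//.
    by apply: le_lt_trans ay _; lra.
  have [s sE] := Et _ e20; exists s => y; rewrite /cb/= => ay.
  have [x /sE[c cs cx] xy] := geodesic_truncate a y geoH t0.
  exists c => //; apply: le_lt_trans (metric_triangle _ x _) _.
  have : mdist x y < e / 2.
    by apply: le_lt_trans xy _; rewrite gt_max e20/=; lra.
  by lra.
have [d d0 td] := compact_thickening lcH
  (totally_bounded_compact (@closed_mdist_le a p) Ep).
have : E (p + d / 2).
  apply: totally_bounded_subset td => y; rewrite /cb/= => ay.
  have [x ax xy] := geodesic_truncate a y geoH p0.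
  exists x => //; apply: le_lt_trans xy _; rewrite gt_max d0/=; lra.
move=> /(ub_le_sup ubE); rewrite -/p; lra.
Qed.

(** [L] bounds one visiting time for each ball of a finite cover that the
curve visits. *)
Lemma totally_bounded_recurrent (u : R -> H) (e : R) :
  totally_bounded (u @` `[0, +oo[) -> 0 < e ->
  exists2 L, 0 <= L & forall t, 0 <= t ->
    exists2 t', 0 <= t' <= L & mdist (u t) (u t') <= e.
Proof.
move=> tu e0; have [s su] := tu _ (divr_gt0 e0 (ltr0Sn R 1)).
suff [L L0 uL] : exists2 L, 0 <= L & forall c t, c \in s -> 0 <= t ->
    mdist c (u t) < e / 2 -> exists2 t', 0 <= t' <= L & mdist c (u t') < e / 2.
  exists L => // t t0.
  have [|c cs ct] := su (u t); first by exists t; rewrite //= in_itv/= t0.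
  have [t' t'L ct'] := uL c t cs t0 ct; exists t' => //.
  apply: le_trans (metric_triangle _ c _) _; rewrite [mdist _ c]metric_sym; lra.
elim: s {su} => [|c s [L L0 IH]]; first by exists 0.
have [[t [t0 ct]]|nc] := pselect (exists t, 0 <= t /\ mdist c (u t) < e / 2).
  exists (L + t) => [|c' t']; first by rewrite addr_ge0.
  rewrite inE => /predU1P[->|c's] t'0 c't'.
    by exists t => //; rewrite t0/= lerDr.
  have [t2 /andP[t20 t2L] ?] := IH c' t' c's t'0 c't'; exists t2 => //.
  by rewrite t20 (le_trans t2L)// lerDl.
exists L => // c' t'; rewrite inE => /predU1P[->|]; last exact: IH.
by move=> t'0 ct'; exfalso; apply: nc; exists t'.
Qed.

End TotallyBounded.

(** * Mean squared distances to an orbit *)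

Section Orbit.
Context {R : realType} {H : completeMetricType R}.
Variables (C : set H) (S : R -> H -> H) (x : H).
Hypotheses (sgS : nonexpansive_semigroup C S) (Cx : C x).

(** The absolute value makes the orbit continuous on the whole line. *)
Let u (t : R) : H := S `|t| x.
Let f (y : H) (t : R) : R := mdist (u t) y ^+ 2.

Let Cu (t : R) : C (u t).
Proof. by have [SC _ _ _ _] := sgS; apply: SC. Qed.

Let uD (t s : R) : 0 <= t -> 0 <= s -> u (t + s) = S t (u s).
Proof.
move=> t0 s0; have [_ _ SD _ _] := sgS.
by rewrite /u !ger0_norm ?addr_ge0// SD.
Qed.

Let continuous_orbit : continuous u.
Proof.
have [_ _ _ /(_ _ Cx)/subspace_continuousP cS _] := sgS.
move=> t; apply: (cvg_comp (fun t : R => `|t|) (fun t => S t x)); last first.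
  by apply: (cS `|t|); rewrite /= in_itv/= normr_ge0.
move=> U [e /= e0 eU]; rewrite /nbhs/=; exists e => //= s ts.
apply: eU; last by rewrite /= in_itv/= normr_ge0.
exact: le_lt_trans (ler_dist_dist _ _) ts.
Qed.

Let continuous_sqdist (y : H) : continuous (f y).
Proof.
have cd : continuous (fun t => mdist (u t) y).
  move=> t; apply/cvgrPdist_le => e e0.
  have /metricType_numDomainType.cvgrPdist_le/(_ _ e0) := @continuous_orbit t.
  apply: filterS => s ts.
  have := metric_triangle (u t) (u s) y; have := metric_triangle (u s) (u t) y.
  rewrite [mdist (u s) (u t)]metric_sym ler_norml => ? ?.
  by apply/andP; split; lra.
have -> : f y = (fun t => mdist (u t) y) * (fun t => mdist (u t) y).
  by apply/funext => t; rewrite /f expr2.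
by move=> t; apply: cvgM; exact: cd.
Qed.

Let mean_sq_distE (T s : R) (y : H) : 0 <= s ->
  mean_sq_dist S x T s y = T^-1 * window (f y) T s.
Proof.
move=> s0; congr (_ * _); apply: eq_Rintegral => t.
by rewrite inE/= in_itv/= => /andP[t0 _]; rewrite /f /u ger0_norm ?addr_ge0.
Qed.

Lemma sqdist_average_mean (A : set H) (T s : R) :
  (forall t, 0 <= t -> A (S t x)) -> 0 < T -> 0 <= s ->
  sqdist_average A (mean_sq_dist S x T s).
Proof.
move=> uA T0 s0 k w kw.
have cw (i : R * H) : continuous (fun t => i.1 * f i.2 t).
  by move=> t; apply: cvgM; [exact: cvg_cst|exact: continuous_sqdist].
have [_] := window_affine w k s cw (ltW T0).
under [X in _ = _ + X]eq_bigr do rewrite windowZ//.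
move=> E; rewrite (_ : _ + _ =
  T^-1 * (k * T + \sum_(i <- w) i.1 * window (f i.2) T s)).
  rewrite mulr_ge0 ?invr_ge0 ?(ltW T0)// -E; apply: Rintegral_ge0 => t _.
  exact/kw/uA.
rewrite mulrDr mulrCA mulVf ?gt_eqF// mulr1 mulr_sumr; congr (_ + _).
by apply: eq_bigr => i _; rewrite mean_sq_distE// mulrCA.
Qed.

(** The orbit from time [t] on is the image under [S t] of the whole orbit. *)
Lemma mean_sq_dist_shift (T t : R) (y : H) : 0 < T -> 0 <= t -> C y ->
  mean_sq_dist S x T t (S t y) <= mean_sq_dist S x T 0 y.
Proof.
move=> T0 t0 Cy; have [_ _ _ _ neS] := sgS.
rewrite !mean_sq_distE// ler_pM2l ?invr_gt0//.
apply: le_Rintegral => //;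
  try exact: (window_integrable _ _ (@continuous_sqdist _)).
move=> s /=; rewrite in_itv/= add0r => /andP[s0 _].
by rewrite /f uD// lerXn2r ?nnegrE ?mdist_ge0//; apply: neS.
Qed.

Variable q : H.
Hypothesis Fq : common_fixed_points C S q.

(** Bounds the distance from [y] to each point of the orbit. *)
Let reach (y : H) : R := mdist x q + mdist q y.

Let reach_ge0 y : 0 <= reach y. Proof. by rewrite addr_ge0 ?mdist_ge0. Qed.

Lemma mdist_orbit_fixed (t : R) : mdist (u t) q <= mdist x q.
Proof.
have [_ _ _ _ neS] := sgS.
have [Cq Stq] : fixed_points C (S `|t|) q.
  by apply: Fq; rewrite /= in_itv/= normr_ge0.
by rewrite /u -{1}Stq neS.
Qed.

Let mdist_orbit (t : R) (y : H) : mdist (u t) y <= reach y.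
Proof.
by apply: le_trans (metric_triangle _ q _) _; rewrite lerD2r mdist_orbit_fixed.
Qed.

Let sqdist_bound (t : R) (y : H) : 0 <= t -> 0 <= f y t <= reach y ^+ 2.
Proof. by move=> _; rewrite sqr_ge0/= lerXn2r ?nnegrE ?mdist_ge0. Qed.

Let sqdist_recurrent (e L : R) (y : H) : 0 <= L ->
  (forall t, 0 <= t -> exists2 t', 0 <= t' <= L & mdist (u t) (u t') <= e) ->
  almost_recurrent (f y) (2 * reach y * e) L.
Proof.
move=> L0 uL; split=> // t t0; have [t' /andP[t'0 t'L] tt'] := uL t t0.
exists t' => [|r r0]; first by rewrite t'0.
have [_ _ _ _ neS] := sgS.
have d : mdist (u (t + r)) (u (t' + r)) <= e.
  by rewrite ![_ + r]addrC !uD//; apply: le_trans tt'; apply: neS.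
have {}d : `|mdist (u (t + r)) y - mdist (u (t' + r)) y| <= e.
  have := metric_triangle (u (t + r)) (u (t' + r)) y.
  have := metric_triangle (u (t' + r)) (u (t + r)) y.
  rewrite [mdist (u (t' + r)) (u (t + r))]metric_sym ler_norml => ? ?.
  by apply/andP; split; lra.
rewrite /f subr_sqr normrM mulrC ler_pM// ger0_norm ?addr_ge0 ?mdist_ge0//.
have := mdist_orbit (t + r) y; have := mdist_orbit (t' + r) y; lra.
Qed.

Hypothesis tb : totally_bounded (u @` `[0, +oo[).

Lemma mean_sq_dist_limit : exists F : H -> R,
  forall (y0 : R) (e : R), 0 < e -> exists2 T0, 0 < T0 &
    forall T s y, T0 <= T -> 0 <= s -> mdist q y <= y0 ->
      `|mean_sq_dist S x T s y - F y| <= e.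
Proof.
have /choice[F FE] : forall y, exists m, forall e L,
    almost_recurrent (f y) e L -> forall T s, 0 < T -> 0 <= s ->
    `|T^-1 * window (f y) T s - m| <= 2 * (e + reach y ^+ 2 * L / T).
  by move=> y; apply: uniform_mean => // t; apply: sqdist_bound.
exists F => y0 e e0.
pose b := mdist x q + `|y0|.
have b0 : 0 <= b by rewrite addr_ge0 ?mdist_ge0.
pose e' := e / (8 * (b + 1)).
have e'0 : 0 < e' by rewrite divr_gt0// mulr_gt0//; lra.
have [L L0 uL] := totally_bounded_recurrent tb e'0.
have c0 : 0 <= 4 * (b ^+ 2 * L) / e.
  by rewrite divr_ge0 ?(ltW e0)// !mulr_ge0// sqr_ge0.
exists (4 * (b ^+ 2 * L) / e + 1) => [|T s y TT s0 yb].
  by rewrite ltr_wpDl.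
have T0 : 0 < T by apply: lt_le_trans TT; rewrite ltr_wpDl.
have yb' : reach y <= b.
  by rewrite lerD2l (le_trans yb)// ler_norm.
rewrite mean_sq_distE//.
apply: le_trans (FE y _ _ (sqdist_recurrent y L0 uL) T s T0 s0) _.
have h1 : reach y * e' <= e / 8.
  apply: (@le_trans _ _ ((b + 1) * e')); first by rewrite ler_pM2r//; lra.
  rewrite /e' le_eqVlt; apply/orP; left; apply/eqP; field.
  by rewrite gt_eqF//; lra.
have h2 : reach y ^+ 2 * L / T <= e / 4.
  rewrite ler_pdivrMr//; apply: (@le_trans _ _ (b ^+ 2 * L)).
    by rewrite ler_wpM2r// lerXn2r ?nnegrE.
  have : 4 * (b ^+ 2 * L) / e <= T by lra.
  by rewrite ler_pdivrMr//; lra.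
lra.
Qed.

End Orbit.

(** * Almost convergence *)

Section AlmostConvergence.
Context {R : realType} {H : completeMetricType R}.

Lemma almost_convergentP (S : R -> H -> H) (x z : H) :
  (forall e : R, 0 < e -> exists T0 : R, forall T s, T0 <= T -> 0 <= s ->
    mdist (sigma S x T s) z <= e) -> almost_convergent S x z.
Proof.
move=> hS A [e /= e0 eA].
have [T0 hT] := hS _ (divr_gt0 e0 (ltr0Sn R 1)).
have nT : \forall T \near +oo, T0 <= T.
  by apply: nbhs_pinfty_ge; exact: num_real.
suff : \forall T \near +oo,
  A (ereal_sup [set (mdist (sigma S x T s) z)%:E | s in `[0, +oo[]) by [].
near=> T.
have TT : T0 <= T by near: T.
set v := ereal_sup _.
have v0 : (0 <= v)%E.
  apply: (@le_trans _ _ (mdist (sigma S x T 0) z)%:E).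
    by rewrite lee_fin mdist_ge0.
  by apply: ereal_sup_ubound; exists 0 => //=; rewrite in_itv/= lexx.
have ve : (v <= (e / 2)%:E)%E.
  apply: ge_ereal_sup => _ [s /= s0 <-]; rewrite lee_fin; apply: hT => //.
  by move: s0; rewrite in_itv/= andbT.
case: v v0 ve => [r| |] //; rewrite !lee_fin => r0 re.
apply: eA; rewrite /ball_/= sub0r normrN ger0_norm//; lra.
Unshelve. all: by end_near. Qed.

End AlmostConvergence.

Theorem theorem5p6 (R : realType) (H : completeMetricType R)
    (C : set H) (S : R -> H -> H) :
  CAT0 H ->
  locally_compact [set: H] ->
  C !=set0 ->
  closed C ->
  geodesically_convex C ->
  nonexpansive_semigroup C S ->
  common_fixed_points C S !=set0 ->
  forall x, C x ->
    exists2 z, common_fixed_points C S z & almost_convergent S x z.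
Proof.
move=> catH lcH C0 clC cvxC sgS [q Fq] x Cx.
have [geoH _] := catH; have [SC _ _ _ _] := sgS.
have tb : totally_bounded ((fun t : R => S `|t| x) @` `[0, +oo[).
  apply: totally_bounded_subset (totally_bounded_ball q (mdist x q) geoH lcH).
  by move=> _ [t _ <-] /=; rewrite metric_sym; apply: mdist_orbit_fixed Fq _.
have [F FE] := mean_sq_dist_limit sgS Cx Fq tb.
have FC : sqdist_average C F.
  apply: (@sqdist_average_cvg _ _ C (fun n => mean_sq_dist S x n.+1%:R 0)).
    by by move=> n; apply: (sqdist_average_mean sgS Cx) => // t /SC; exact.
  move=> y; apply/cvgrPdist_le => e e0.
  have [T0 _ FT] := FE (mdist q y) e e0.
  apply: filterS (nbhs_infty_ger T0) => n T0n.
  by rewrite distrC; apply: FT => //; apply: le_trans T0n _; rewrite ler_nat.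
have [z Cz zmin] := sqdist_average_minimizer_in catH clC cvxC C0 FC.
exists z.
  move=> t /=; rewrite in_itv/= andbT => t0; split => //.
  have Fz : F (S t z) <= F z.
    apply/ler_addgt0Pr => e e0.
    have [T1 T10 FT1] := FE (mdist q z) _ (divr_gt0 e0 (ltr0Sn R 1)).
    have [T2 T20 FT2] := FE (mdist q (S t z)) _ (divr_gt0 e0 (ltr0Sn R 1)).
    pose T := Num.max T1 T2.
    have T12 : 0 < T by rewrite lt_max T10.
    have TT1 : T1 <= T by rewrite le_max lexx.
    have TT2 : T2 <= T by rewrite le_max lexx orbT.
    have := mean_sq_dist_shift sgS Cx T12 t0 Cz.
    have := FT1 T 0 z TT1 (lexx _) (lexx _).
    have := FT2 T t (S t z) TT2 t0 (lexx _).
    by rewrite !ler_norml => /andP[? ?] /andP[? ?]; lra.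
  apply: mdist_positivity; apply/eqP; rewrite -sqrf_eq0 eq_le sqr_ge0 andbT.
  by apply: le_trans (zmin _) _; rewrite subr_le0.
apply: almost_convergentP => e e0.
(* D bounds the distance from z to the orbit, hence also from z to sigma *)
pose D := mdist x q + mdist q z.
have e20 : 0 < e ^+ 2 / 2 by rewrite divr_gt0// exprn_gt0.
have [T0 T00 FT] := FE (mdist q z + D) _ e20.
exists T0 => T s TT s0.
have Tgt0 : 0 < T by exact: lt_le_trans TT.
have GC : sqdist_average C (mean_sq_dist S x T s).
  by apply: (sqdist_average_mean sgS Cx) => // t /SC; exact.
have [y _ ymin] := sqdist_average_minimizer_in catH clC cvxC C0 GC.
have -> : sigma S x T s = y.
  have ym : minimizers (mean_sq_dist S x T s) y.
    by move=> w; rewrite -subr_ge0; apply: le_trans (ymin w); exact: sqr_ge0.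
  have sm := xgetPex x (ex_intro _ y ym).
  apply: mdist_positivity; apply/eqP; rewrite -sqrf_eq0 eq_le sqr_ge0 andbT.
  by apply: le_trans (ymin _) _; rewrite subr_le0; exact: sm.
have Gy := sqdist_average_ge0 y GC.
have D0 : 0 <= D by rewrite addr_ge0 ?mdist_ge0.
have GzD : mean_sq_dist S x T s z <= D ^+ 2.
  have : sqdist_average [set a | mdist a z <= D] (mean_sq_dist S x T s).
    apply: (sqdist_average_mean sgS Cx) => // t t0 /=.
    apply: le_trans (metric_triangle _ q _) _; rewrite lerD2r.
    by have := mdist_orbit_fixed sgS Cx Fq t; rewrite ger0_norm.
  move=> /(_ (D ^+ 2) [:: (-1, z)]).
  rewrite !big_cons !big_nil/= !addr0 mulN1r subr_ge0; apply=> a /= az.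
  rewrite big_cons big_nil/= addr0 mulN1r subr_ge0.
  by rewrite lerXn2r ?nnegrE ?mdist_ge0.
have yz : mdist q y <= mdist q z + D.
  apply: le_trans (metric_triangle _ z _) _; rewrite lerD2l.
  rewrite -(ler_pXn2r (_ : 0 < 2)%N) ?nnegrE ?mdist_ge0//.
  by have := ymin z; lra.
have qz : mdist q z <= mdist q z + D by rewrite lerDl.
have := FT T s y TT s0 yz; have := FT T s z TT s0 qz.
rewrite !ler_norml => /andP[? ?] /andP[? ?].
rewrite -(ler_pXn2r (_ : 0 < 2)%N) ?nnegrE ?mdist_ge0 ?(ltW e0)//.
have := zmin y; have := ymin z; have := sqr_ge0 (mdist z y).
lra.
Qed.
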